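(* Let $0<\alpha<1$, $\beta\in(0,1]$, $\gamma\in(1,2]$, let $a<b$, $T>0$, let $m\ge 2$, $n\ge 1$ be integers, and let $d_\pm,e_\pm$ be non-negative real functions on $[a,b]\times[0,T]$. Then the implicit difference method described in the context is unconditionally stable, in the following sense. Let $\xi_i^{(k)}$ ($0\le i\le m$, $0\le k\le n$) be real numbers with $\xi_0^{(k)}=\xi_m^{(k)}=0$ for $1\le k\le n$ that satisfy the error equation $$\xi_i^{(k+1)}+\omega_1\Big(d_{+,i}^{(k+1)}\sum_{j=0}^{i}g_j^{(\beta)}\xi_{i-j}^{(k+1)}+d_{-,i}^{(k+1)}\sum_{j=0}^{m-i}g_j^{(\beta)}\xi_{i+j}^{(k+1)}\Big)-\omega_2\Big(e_{+,i}^{(k+1)}\sum_{j=0}^{i+1}g_j^{(\gamma)}\xi_{i-j+1}^{(k+1)}+e_{-,i}^{(k+1)}\sum_{j=0}^{m-i+1}g_j^{(\gamma)}\xi_{i+j-1}^{(k+1)}\Big)=\xi_i^{(k)}-\sum_{j=1}^{k}a_j\big(\xi_i^{(k-j+1)}-\xi_i^{(k-j)}\big)$$ for all $1\le i\le m-1$, $0\le k\le n-1$ (the last sum being empty for $k=0$). With $E^{(k)}=(\xi_1^{(k)},\dots,\xi_{m-1}^{(k)})^\top$, one has, with no restriction relating the time step and the mesh width, $$\|E^{(k+1)}\|_\infty\le\|E^{(0)}\|_\infty,\qquad 0\le k\le n-1 .$$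
   Context: Notation. $h=(b-a)/m$, $\tau=T/n$, $x_i=a+ih$ ($0\le i\le m$), $t_j=j\tau$ ($0\le j\le n$). $d_{\pm,i}^{(j)}=d_\pm(x_i,t_j)$, $e_{\pm,i}^{(j)}=e_\pm(x_i,t_j)$. $a_0=1$ and $a_j=(j+1)^{1-\alpha}-j^{1-\alpha}$. For $\theta\in\{\beta,\gamma\}$: $g_0^{(\theta)}=1$, $g_j^{(\theta)}=\frac{(-1)^j}{j!}\theta(\theta-1)\cdots(\theta-j+1)$ for $j\ge1$. $\omega_1=\Gamma(2-\alpha)\tau^\alpha/h^\beta$, $\omega_2=\Gamma(2-\alpha)\tau^\alpha/h^\gamma$, $\omega_3=\Gamma(2-\alpha)\tau^\alpha$. $\|\cdot\|_\infty$ is the maximum norm. The implicit difference method (for given functions $\phi$ on $[a,b]$ and $f$ on $[a,b]\times[0,T]$, with $f_i^{(j)}=f(x_i,t_j)$) determines $u_i^{(k)}$ by $$u_i^{(k+1)}+\omega_1\Big(d_{+,i}^{(k+1)}\sum_{j=0}^{i}g_j^{(\beta)}u_{i-j}^{(k+1)}+d_{-,i}^{(k+1)}\sum_{j=0}^{m-i}g_j^{(\beta)}u_{i+j}^{(k+1)}\Big)-\omega_2\Big(e_{+,i}^{(k+1)}\sum_{j=0}^{i+1}g_j^{(\gamma)}u_{i-j+1}^{(k+1)}+e_{-,i}^{(k+1)}\sum_{j=0}^{m-i+1}g_j^{(\gamma)}u_{i+j-1}^{(k+1)}\Big)=u_i^{(k)}-\sum_{j=1}^{k}a_j\big(u_i^{(k-j+1)}-u_i^{(k-j)}\big)+\omega_3f_i^{(k+1)}$$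 for $1\le i\le m-1$, $0\le k\le n-1$, with $u_i^{(0)}=\phi(x_i)$ for $0\le i\le m$ and $u_0^{(k)}=u_m^{(k)}=0$ for $1\le k\le n$. The numbers $\xi_i^{(k)}=U_i^{(k)}-u_i^{(k)}$ are the differences of two solutions of this scheme with the same $f$ and different initial data. *)

(* Defs.v *)
From HB Require Import structures.
From mathcomp Require Export all_boot all_order all_algebra.
From mathcomp Require Export all_classical all_reals all_analysis.

Set Implicit Arguments.
Unset Strict Implicit.
Unset Printing Implicit Defensive.

Import Order.TTheory GRing.Theory Num.Theory.
Import numFieldNormedType.Exports.

Local Open Scope classical_set_scope.
Local Open Scope ring_scope.

(* Euler's integral; it converges, and so equals Gamma(z), exactly for z > 0
   (the real-valued integral takes the value 0 when it diverges). *)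
Definition Gamma (R : realType) (z : R) : R :=
  \int[@lebesgue_measure R]_(t in `]0, +oo[) (t `^ (z - 1) * expR (- t)).

(* Weights of the L1 discretisation of the Caputo derivative of order alpha. *)
Definition acoef (R : realType) (alpha : R) (j : nat) : R :=
  j.+1%:R `^ (1 - alpha) - j%:R `^ (1 - alpha).

(* Gruenwald weights (-1)^j binom(theta, j). *)
Definition gcoef (R : realType) (theta : R) (j : nat) : R :=
  (-1) ^+ j / j`!%:R * \prod_(l < j) (theta - l%:R).

Definition omega (R : realType) (alpha tau h theta : R) : R :=
  Gamma (2 - alpha) * tau `^ alpha / h `^ theta.

(* Column of the interior values of a grid function at time level k: the row
   index r = 0, ..., m-2 stands for the mesh index r + 1. *)
Definition err_vec (R : realType) (m : nat) (xi : nat -> nat -> R) (k : nat) :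
  'cV[R]_m.-1 := \col_(r < m.-1) xi r.+1 k.

Lemma acoef0 (R : realType) (alpha : R) : alpha < 1 -> acoef alpha 0 = 1.
Proof.
by move=> lt1; rewrite /acoef powR1 powR0 ?subr0// subr_eq0 eq_sym lt_eqF.
Qed.

Lemma gcoef0 (R : realType) (theta : R) : gcoef theta 0 = 1.
Proof. by rewrite /gcoef big_ord0 fact0 expr0 divr1 mulr1. Qed.

(* Main.v *)
Require Import Defs.
From mathcomp Require Import all_boot all_order all_algebra.
From mathcomp Require Import all_classical all_reals all_analysis.
From mathcomp Require Import zify ring lra.

Set Implicit Arguments.
Unset Strict Implicit.
Unset Printing Implicit Defensive.

Import Order.TTheory GRing.Theory Num.Theory.
Import numFieldNormedType.Exports.

Local Open Scope ring_scope.

(** Stability is a discrete maximum principle in space combined with a convexity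
    argument in time.

    Space: for 0 <= theta <= 1 the Gruenwald weights are 1 at index 0 and
    nonpositive afterwards, while their partial sums stay nonnegative; for
    1 <= theta <= 2 every weight except the one of index 1 is nonnegative, while
    the partial sums past the first are nonpositive. This holds because the
    partial sums of the weights of order theta are the weights of order
    [theta - 1] ([sum_gcoef]). Consequently, at a mesh point where the error
    attains its maximum modulus M >= 0 (after a change of sign, its maximum),
    the advection sums are nonnegative ([gcoef_sum_max_ge0]) and the shifted
    diffusion sums nonpositive ([gcoef_sum_max_le0]), so that M is at most the
    right-hand side of the error equation at that point.

    Time: the L1 weights satisfy 1 = a_0 >= a_1 >= ... >= 0, by concavity of
    [x |-> x `^ (1 - alpha)]. After an Abel summation the right-hand side is
    therefore a convex combination of the errors at earlier time levels
    ([L1_history_le]), which are bounded by the initial error by strong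
    induction. *)

(** * Gruenwald weights *)

Section Gruenwald.
Context {R : realType}.
Implicit Types theta M : R.

Lemma gcoefSr theta j :
  gcoef theta j.+1 = gcoef theta j * ((j%:R - theta) / j.+1%:R).
Proof.
rewrite /gcoef big_ord_recr /= exprS factS natrM.
have h1 : j`!%:R != 0 :> R by rewrite pnatr_eq0 -lt0n fact_gt0.
have h2 : j.+1%:R != 0 :> R by rewrite pnatr_eq0.
set P := \prod_(_ < j) _; move: ((-1) ^+ j) h1 h2 => e h1 h2.
move: j.+1%:R h2 => u hu; field.
by rewrite hu h1.
Qed.

Lemma gcoefSl theta j :
  gcoef theta j.+1 = - theta / j.+1%:R * gcoef (theta - 1) j.
Proof.
rewrite /gcoef big_ord_recl /= subr0 exprS factS natrM.
under eq_bigr => l _ do rewrite /bump /= natrD opprD addrA.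
have h1 : j`!%:R != 0 :> R by rewrite pnatr_eq0 -lt0n fact_gt0.
have h2 : j.+1%:R != 0 :> R by rewrite pnatr_eq0.
set P := \prod_(_ < j) _; move: ((-1) ^+ j) h1 h2 => e h1 h2.
move: j.+1%:R h2 => u hu; field.
by rewrite hu h1.
Qed.

Lemma sum_gcoef theta N :
  \sum_(0 <= j < N.+1) gcoef theta j = gcoef (theta - 1) N.
Proof.
elim: N => [|N IH]; first by rewrite big_nat1 !gcoef0.
rewrite big_nat_recr //= IH gcoefSl gcoefSr.
have h2 : N.+1%:R != 0 :> R by rewrite pnatr_eq0.
by rewrite -natr1 in h2 *; field.
Qed.

Lemma gcoef_ge0_nonpos theta j : theta <= 0 -> 0 <= gcoef theta j.
Proof.
move=> h; elim: j => [|j IH]; first by rewrite gcoef0.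
by rewrite gcoefSr mulr_ge0 // divr_ge0 // subr_ge0 (le_trans h).
Qed.

Lemma gcoefS_le0 theta j : 0 <= theta <= 1 -> gcoef theta j.+1 <= 0.
Proof.
case/andP=> h0 h1; rewrite gcoefSl mulNr mulNr oppr_le0 mulr_ge0 ?divr_ge0 //.
by apply: gcoef_ge0_nonpos; rewrite subr_le0.
Qed.

Lemma gcoefSS_ge0 theta j : 1 <= theta <= 2 -> 0 <= gcoef theta j.+2.
Proof.
move=> h; rewrite gcoefSl mulNr mulNr oppr_ge0 mulr_ge0_le0 ?divr_ge0 //.
  by lra.
by apply: gcoefS_le0; lra.
Qed.

(** Advection sums are nonnegative at a maximum: termwise, the sum is at least
    M times the sum of the weights. *)
Lemma gcoef_sum_max_ge0 theta M N (w : nat -> R) :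
  0 <= theta <= 1 -> 0 <= M -> w 0 = M -> (forall j, (j <= N)%N -> w j <= M) ->
  0 <= \sum_(0 <= j < N.+1) gcoef theta j * w j.
Proof.
move=> ht hM w0 wM.
apply: (@le_trans _ _ (\sum_(0 <= j < N.+1) gcoef theta j * M)).
  rewrite -mulr_suml sum_gcoef mulr_ge0 // gcoef_ge0_nonpos //.
  by case/andP: ht; rewrite subr_le0.
apply: ler_sum_nat => -[|j] /= hj; first by rewrite w0.
by apply: ler_wnM2l; [exact: gcoefS_le0|exact: wM].
Qed.

(** Diffusion sums are nonpositive at a maximum. Because of the shift in the
    discretisation the maximum sits at index 1, that of the only negative
    weight. *)
Lemma gcoef_sum_max_le0 theta M N (w : nat -> R) :
  1 <= theta <= 2 -> 0 <= M -> w 1 = M ->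
  (forall j, (j <= N.+1)%N -> w j <= M) ->
  \sum_(0 <= j < N.+2) gcoef theta j * w j <= 0.
Proof.
move=> ht hM w1 wM.
apply: (@le_trans _ _ (\sum_(0 <= j < N.+2) gcoef theta j * M)); last first.
  rewrite -mulr_suml sum_gcoef mulr_le0_ge0 // gcoefS_le0 //.
  by lra.
apply: ler_sum_nat => -[|[|j]] /= hj; last 2 first.
- by rewrite w1.
- by apply: ler_wpM2l; [exact: gcoefSS_ge0|exact: wM].
- by rewrite gcoef0 !mul1r wM.
Qed.

End Gruenwald.

(** * Weights of the L1 discretisation *)

Section L1weights.
Context {R : realType}.
Implicit Types alpha p x y E : R.

Lemma acoef_ge0 alpha j : alpha <= 1 -> 0 <= acoef alpha j.
Proof.
move=> h; rewrite /acoef subr_ge0 ge0_ler_powR ?nnegrE ?subr_ge0 //.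
by rewrite ler_nat.
Qed.

(** Midpoint concavity of the power function, obtained from convexity of the
    power function of inverse exponent. *)
Lemma powR_midpoint_concave p x y : 0 < p <= 1 -> 0 <= x -> 0 <= y ->
  (x `^ p + y `^ p) / 2 <= ((x + y) / 2) `^ p.
Proof.
case/andP=> p0 p1 x0 y0.
have q1 : 1 <= p^-1 by rewrite invf_ge1.
have half0 : 0 <= 2^-1 :> R by lra.
have half1 : 2^-1 <= 1 :> R by lra.
have := convex_powR q1 (Itv01 half0 half1) (x := x `^ p) (y := y `^ p).
rewrite !inE /= !in_itv /= !powR_ge0 => /(_ erefl erefl).
rewrite convRE /conv /= /GRing.scale /= -!powRrM !mulfV ?gt_eqF // !powRr1 //.
have -> : unstable.onem 2^-1 = 2^-1 :> R by rewrite /unstable.onem; lra.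
rewrite -!mulrDr ![2^-1 * _]mulrC.
have avg0 : 0 <= (x `^ p + y `^ p) / 2 by rewrite divr_ge0 ?addr_ge0 ?powR_ge0.
move=> le1; rewrite -[leLHS]powRr1 //.
rewrite -[X in _ `^ X <= _](mulVf (lt0r_neq0 p0)) powRrM.
by apply: (ge0_ler_powR (ltW p0)) le1;
  rewrite nnegrE ?powR_ge0 ?divr_ge0 ?addr_ge0.
Qed.

Lemma acoef_decr alpha j : 0 <= alpha < 1 -> acoef alpha j.+1 <= acoef alpha j.
Proof.
move=> ha; have hp : 0 < 1 - alpha <= 1 by lra.
have := powR_midpoint_concave hp (ler0n R j) (ler0n R j.+2).
have -> : (j%:R + j.+2%:R) / 2 = j.+1%:R :> R.
  by rewrite -[j.+2]addn2 -[j.+1]addn1 !natrD; field.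
by rewrite /acoef; lra.
Qed.

(** Abel summation of the first K terms of the memory sum gives the weight
    [1 - acoef alpha K] to the levels already summed and leaves the remaining
    weight on level [k - K]. *)
Lemma L1_history_partial_le alpha E (v : nat -> R) (k K : nat) :
  0 <= alpha < 1 -> (forall l, (l <= k)%N -> v l <= E) -> (K <= k)%N ->
  v k - \sum_(1 <= j < K.+1) acoef alpha j * (v (k - j).+1 - v (k - j)%N)
    <= (1 - acoef alpha K) * E + acoef alpha K * v (k - K)%N.
Proof.
move=> ha vE; elim: K => [|K IH] hK.
  rewrite big_geq // acoef0; last by case/andP: ha.
  by rewrite subn0 subrr mul0r add0r mul1r subr0.
rewrite big_nat_recr //=.
have := IH (ltnW hK).
have -> : (k - K.+1).+1 = (k - K)%N by lia.
have := vE _ (leq_subr K k).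
have := acoef_decr K ha.
rewrite -subr_ge0 => /ler_wpM2l h /h {h}.
set S := \sum_(_ <= _ < _) _.
by nra.
Qed.

Lemma L1_history_le alpha E (v : nat -> R) (k : nat) :
  0 <= alpha < 1 -> (forall l, (l <= k)%N -> v l <= E) ->
  v k - \sum_(1 <= j < k.+1) acoef alpha j * (v (k - j).+1 - v (k - j)%N) <= E.
Proof.
move=> ha vE; apply: le_trans (L1_history_partial_le ha vE (leqnn k)) _.
have : acoef alpha k * v (k - k)%N <= acoef alpha k * E.
  by rewrite ler_wpM2l ?acoef_ge0 ?vE ?leq_subr //; lra.
by lra.
Qed.

End L1weights.

(** * Stability *)

Lemma Gamma_ge0 (R : realType) (z : R) : 0 <= Gamma z.
Proof.
by apply: Rintegral_ge0 => u _; rewrite mulr_ge0 ?powR_ge0 ?expR_ge0.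
Qed.

Lemma omega_ge0 (R : realType) (alpha tau h theta : R) :
  0 <= omega alpha tau h theta.
Proof. by rewrite divr_ge0 ?mulr_ge0 ?powR_ge0 ?Gamma_ge0. Qed.

Lemma err_vec_ge (R : realType) (m : nat) (xi : nat -> nat -> R) (i k : nat) :
  (1 <= i <= m - 1)%N -> `|xi i k| <= `|err_vec m xi k|.
Proof.
move=> hi; have hr : (i.-1 < m.-1)%N by lia.
have -> : `|err_vec m xi k| = \big[Num.max/0]_ij `|err_vec m xi k ij.1 ij.2|.
  by rewrite -mx_normrE.
have := le_bigmax 0 (fun ij => `|err_vec m xi k ij.1 ij.2|) (Ordinal hr, ord0).
by rewrite mxE /= prednK //; lia.
Qed.

Lemma err_vec_attained (R : realType) (m : nat) (xi : nat -> nat -> R)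
    (k : nat) :
  (2 <= m)%N ->
  exists2 i : nat, (1 <= i <= m - 1)%N & `|err_vec m xi k| = `|xi i k|.
Proof.
move=> hm; have hr : (0 < m.-1)%N by lia.
have -> : `|err_vec m xi k| = \big[Num.max/0]_ij `|err_vec m xi k ij.1 ij.2|.
  by rewrite -mx_normrE.
have [|[r c] _ ->] := @eq_bigmax _ _ _ 0 (Ordinal hr, ord0) predT
  (fun ij => `|err_vec m xi k ij.1 ij.2|) erefl.
  by move=> ? _; exact: normr_ge0.
by exists r.+1; [have := ltn_ord r; lia|rewrite mxE].
Qed.

(** The left-hand side of the scheme at mesh point i, for one time level
    u: at a nonnegative maximum of u it is at least that maximum. *)
Lemma implicit_operator_max_ge (R : realType)
    (beta gamma om1 om2 dp dm ep em : R) (m i : nat) (u : nat -> R) :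
  0 <= beta <= 1 -> 1 <= gamma <= 2 -> 0 <= om1 -> 0 <= om2 ->
  0 <= dp -> 0 <= dm -> 0 <= ep -> 0 <= em -> (1 <= i <= m - 1)%N ->
  0 <= u i -> (forall j, (j <= m)%N -> u j <= u i) ->
  u i <= u i
    + om1 * (dp * (\sum_(0 <= j < i.+1) gcoef beta j * u (i - j)%N)
             + dm * (\sum_(0 <= j < (m - i).+1) gcoef beta j * u (i + j)%N))
    - om2 * (ep * (\sum_(0 <= j < i.+2) gcoef gamma j * u (i.+1 - j)%N)
             + em * (\sum_(0 <= j < (m - i).+2)
                       gcoef gamma j * u (i + j - 1)%N)).
Proof.
move=> hbeta hgamma om1ge0 om2ge0 dp0 dm0 ep0 em0 hi ui0 umax.
rewrite -addrA lerDl addr_ge0 ?oppr_ge0 //.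
  rewrite mulr_ge0 // addr_ge0 // mulr_ge0 //.
    apply: (gcoef_sum_max_ge0 hbeta ui0); first by rewrite subn0.
    by move=> j ji; apply: umax; clear -hi ji; lia.
  apply: (gcoef_sum_max_ge0 hbeta ui0); first by rewrite addn0.
  by move=> j ji; apply: umax; clear -hi ji; lia.
rewrite mulr_ge0_le0 // -oppr_ge0 opprD addr_ge0 // oppr_ge0 mulr_ge0_le0 //.
  apply: (gcoef_sum_max_le0 hgamma ui0); first by rewrite subn1.
  by move=> j ji; apply: umax; clear -hi ji; lia.
apply: (gcoef_sum_max_le0 hgamma ui0); first by rewrite addnK.
by move=> j ji; apply: umax; clear -hi ji; lia.
Qed.

(** Stability for arbitrary nonnegative grid coefficients and mesh ratios. *)
Lemma err_vec_le_initial (R : realType) (alpha beta gamma om1 om2 : R)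
    (m n : nat) (dp dm ep em xi : nat -> nat -> R) :
  0 <= alpha < 1 -> 0 <= beta <= 1 -> 1 <= gamma <= 2 ->
  0 <= om1 -> 0 <= om2 -> (2 <= m)%N ->
  (forall i k, (i <= m)%N -> (k < n)%N ->
     [/\ 0 <= dp i k.+1, 0 <= dm i k.+1, 0 <= ep i k.+1 & 0 <= em i k.+1]) ->
  (forall k, (k < n)%N -> xi 0%N k.+1 = 0 /\ xi m k.+1 = 0) ->
  (forall i k, (1 <= i <= m - 1)%N -> (k < n)%N ->
    xi i k.+1
    + om1 *
      (dp i k.+1 * (\sum_(0 <= j < i.+1) gcoef beta j * xi (i - j)%N k.+1)
       + dm i k.+1 *
         (\sum_(0 <= j < (m - i).+1) gcoef beta j * xi (i + j)%N k.+1))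
    - om2 *
      (ep i k.+1 *
         (\sum_(0 <= j < i.+2) gcoef gamma j * xi (i.+1 - j)%N k.+1)
       + em i k.+1 *
         (\sum_(0 <= j < (m - i).+2) gcoef gamma j * xi (i + j - 1)%N k.+1))
    = xi i k
      - \sum_(1 <= j < k.+1)
          acoef alpha j * (xi i (k - j).+1 - xi i (k - j)%N)) ->
  forall k, (k < n)%N -> `|err_vec m xi k.+1| <= `|err_vec m xi 0|.
Proof.
move=> halpha hbeta hgamma om1ge0 om2ge0 hm coef_ge0 hbdry scheme k.
elim/ltn_ind: k => k IH hk.
have [i hi Mi] := err_vec_attained xi k.+1 hm.
have im : (i <= m)%N by clear -hi; lia.
have [dp0 dm0 ep0 em0] := coef_ge0 i k im hk.
have := scheme i k hi hk.
(* Multiplying by the sign s of the extremal value turns it into a maximum. *)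
have [s sle sM] : exists2 s : R,
    (forall y C, `|y| <= C -> s * y <= C) & s * xi i k.+1 = `|xi i k.+1|.
  exists (Num.sg (xi i k.+1)); last by rewrite -normrEsg.
  move=> y C yC; apply: le_trans (ler_norm _) _; rewrite normrM normr_sg.
  by case: (_ != 0); rewrite ?mul1r // mul0r (le_trans _ yC).
have new_le j : (j <= m)%N -> s * xi j k.+1 <= s * xi i k.+1.
  move=> jm; rewrite sM -Mi; apply: sle.
  have [xi0 xim] := hbdry k hk.
  have [->|j0] := eqVneq j 0%N; first by rewrite xi0 normr0.
  have [->|jm'] := eqVneq j m; first by rewrite xim normr0.
  by apply: err_vec_ge; clear -jm j0 jm'; lia.
have old_le l : (l <= k)%N -> s * xi i l <= `|err_vec m xi 0|.
  move=> lk; apply: sle; apply: le_trans (err_vec_ge _ _ hi) _.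
  by case: l lk => [//|l] lk; apply: IH => //; exact: ltn_trans lk hk.
have si0 : 0 <= s * xi i k.+1 by rewrite sM.
have := L1_history_le halpha old_le.
have := implicit_operator_max_ge hbeta hgamma om1ge0 om2ge0 dp0 dm0 ep0 em0 hi
  si0 new_le.
have pull N (g w : nat -> R) :
    \sum_(0 <= j < N) g j * (s * w j) = s * (\sum_(0 <= j < N) g j * w j).
  by rewrite mulr_sumr; apply: eq_bigr => j _; rewrite mulrCA.
have pull2 (c d e A B : R) :
  c * (d * (s * A) + e * (s * B)) = s * (c * (d * A + e * B)) by ring.
rewrite !pull !pull2 -mulrDr -mulrBr => lower hist scheme_i.
rewrite Mi -sM; apply: le_trans lower _; rewrite scheme_i mulrBr.
rewrite mulr_sumr; under eq_bigr => j _ do rewrite mulrCA mulrBr.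
exact: hist.
Qed.

(* The infinity norm is the library's norm on matrices, the maximum of the
   absolute values of the entries. Only the values xi i k with i <= m and k <= n
   matter. *)
Theorem theorem2p2 (R : realType) (alpha beta gamma a b T : R) (m n : nat)
    (dp dm ep em : R -> R -> R)
    (halpha : 0 < alpha < 1) (hbeta : 0 < beta <= 1) (hgamma : 1 < gamma <= 2)
    (hab : a < b) (hT : 0 < T) (hm : (2 <= m)%N) (hn : (1 <= n)%N)
    (hdp : forall x t : R, a <= x <= b -> 0 <= t <= T -> 0 <= dp x t)
    (hdm : forall x t : R, a <= x <= b -> 0 <= t <= T -> 0 <= dm x t)
    (hep : forall x t : R, a <= x <= b -> 0 <= t <= T -> 0 <= ep x t)
    (hem : forall x t : R, a <= x <= b -> 0 <= t <= T -> 0 <= em x t)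
    (xi : nat -> nat -> R)
    (hbdry : forall k, (1 <= k <= n)%N -> xi 0%N k = 0 /\ xi m k = 0) :
  let h := (b - a) / m%:R in
  let tau := T / n%:R in
  let x (i : nat) := a + i%:R * h in
  let t (j : nat) := j%:R * tau in
  let omega1 := omega alpha tau h beta in
  let omega2 := omega alpha tau h gamma in
  (forall i k : nat, (1 <= i <= m - 1)%N -> (k <= n - 1)%N ->
    xi i k.+1
    + omega1 *
      (dp (x i) (t k.+1) *
         (\sum_(0 <= j < i.+1) gcoef beta j * xi (i - j)%N k.+1)
       + dm (x i) (t k.+1) *
         (\sum_(0 <= j < (m - i).+1) gcoef beta j * xi (i + j)%N k.+1))
    - omega2 *
      (ep (x i) (t k.+1) *
         (\sum_(0 <= j < i.+2) gcoef gamma j * xi (i.+1 - j)%N k.+1)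
       + em (x i) (t k.+1) *
         (\sum_(0 <= j < (m - i).+2) gcoef gamma j * xi (i + j - 1)%N k.+1))
    = xi i k
      - \sum_(1 <= j < k.+1)
          acoef alpha j * (xi i (k - j).+1 - xi i (k - j)%N)) ->
  forall k : nat, (k <= n - 1)%N ->
    `| err_vec m xi k.+1 | <= `| err_vec m xi 0 |.
Proof.
move=> h tau x t omega1 omega2 scheme k hk.
have m0 : 0 < m%:R :> R by rewrite ltr0n (ltn_trans _ hm).
have n0 : 0 < n%:R :> R by rewrite ltr0n.
have xP i : (i <= m)%N -> a <= x i <= b.
  move=> im; have h0 : 0 < h by rewrite divr_gt0 ?subr_gt0.
  have hmb : m%:R * h = b - a by rewrite /h mulrC divfK // gt_eqF.
  apply/andP; split; first by rewrite /x lerDl mulr_ge0 // ltW.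
  by rewrite /x -lerBrDl -hmb ler_pM2r // ler_nat.
have tP j : (j <= n)%N -> 0 <= t j <= T.
  move=> jn; have tau0 : 0 < tau by rewrite divr_gt0.
  have hnT : n%:R * tau = T by rewrite /tau mulrC divfK // gt_eqF.
  apply/andP; split; first by rewrite /t mulr_ge0 // ltW.
  by rewrite /t -[leRHS]hnT ler_pM2r // ler_nat.
have ltn_n l : (l <= n - 1)%N = (l < n)%N by clear -hn; lia.
have [alpha_gt0 alpha_lt1] := andP halpha.
have [beta_gt0 beta_le1] := andP hbeta.
have [gamma_gt1 gamma_le2] := andP hgamma.
apply: (@err_vec_le_initial R alpha beta gamma omega1 omega2 m n
  (fun i j => dp (x i) (t j)) (fun i j => dm (x i) (t j))
  (fun i j => ep (x i) (t j)) (fun i j => em (x i) (t j))) => //.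
- by rewrite ltW.
- by rewrite ltW.
- by rewrite ltW.
- exact: omega_ge0.
- exact: omega_ge0.
- move=> i l im ln; have xi_ab := xP i im; have tl := tP l.+1 ln.
  by split; [exact: hdp|exact: hdm|exact: hep|exact: hem].
- by move=> l ln; apply: hbdry.
- by move=> i l hi ln; apply: scheme; rewrite ?ltn_n.
- by rewrite -ltn_n.
Qed.
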